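(* For any three graphs $G$, $H$ and $K$, the complex $\mathrm{Hom}(G\times H,K)$ is simple homotopy equivalent (in the sense of Whitehead) to $\mathrm{Hom}(G,K^H)$.
   Context: Graphs are undirected, loops are allowed, multiple edges are not; $E(G)$ is regarded as a symmetric subset of $V(G)\times V(G)$. The direct product $G\times H$ of graphs has vertex set $V(G)\times V(H)$ and edge set $\{((x,y),(x',y')) : (x,x')\in E(G),\ (y,y')\in E(H)\}$. The power graph $K^H$ has as vertices all set maps $f:V(H)\to V(K)$, and $(f,g)\in E(K^H)$ if and only if, whenever $(v,w)\in E(H)$, also $(f(v),g(w))\in E(K)$. For graphs $T,G$, $\mathrm{Hom}(T,G)$ is the polyhedral complex whose cells are indexed by all functions $\eta:V(T)\to 2^{V(G)}\setminus\{\emptyset\}$ (with all $\eta(x)$ finite and $|\eta(x)|\ge 2$ for only finitely many $x$) such that $(x,y)\in E(T)$ implies $\eta(x)\times\eta(y)\subseteq E(G)$. The cell $\eta$ is the product of simplices $\prod_{x\in V(T)}\Delta^{\eta(x)}$ inside the weak direct product of copies of the simplex $\Delta^{V(G)}$ indexed by $V(T)$; its closure consists of all cells $\tilde\eta$ with $\tilde\eta(x)\subseteq\eta(x)$ for all $x\in V(T)$.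
   Formalization: Both complexes Hom(G×H,K) and Hom(G,K^H) are assumed finite, as Whitehead's notion requires; for infinite graphs the claim can fail: for G a point, H infinite, K two points, all edgeless, the first complex is disconnected and the second is a simplex. *)

(* Defs.v *)
From HB Require Import structures.
From mathcomp Require Import all_boot all_order all_algebra.
From mathcomp Require Import all_classical reals.
From Stdlib Require Import Relation_Operators.

Set Implicit Arguments.
Unset Strict Implicit.
Unset Printing Implicit Defensive.

Import Order.TTheory GRing.Theory Num.Theory.

Local Open Scope classical_set_scope.
Local Open Scope ring_scope.

(* Vertex sets may be infinite. *)
Record graph := Graph {
  vertex :> Type;
  edge : vertex -> vertex -> Prop;
  edge_sym : forall x y, edge x y -> edge y x }.

Lemma gprod_sym (G H : graph) (p q : G * H) :
  edge p.1 q.1 /\ edge p.2 q.2 -> edge q.1 p.1 /\ edge q.2 p.2.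
Proof. by case=> /edge_sym pq1 /edge_sym pq2. Qed.

Definition gprod (G H : graph) : graph := Graph (@gprod_sym G H).

Lemma gpower_sym (K H : graph) (f g : H -> K) :
  (forall v w, edge v w -> edge (f v) (g w)) ->
  forall v w, edge v w -> edge (g v) (f w).
Proof. by move=> fg v w /edge_sym /fg /edge_sym. Qed.

Definition gpower (K H : graph) : graph := Graph (@gpower_sym K H).

(* The faces of a polytope are represented by the points they contain of a
   finite set A of which the polytope is the convex hull: F is the trace on A
   of a nonempty face, the set where some linear form l is maximal on A. Each
   face is determined by its trace, and inclusion of faces is inclusion of
   traces. The polytope itself is the face given by l = 0. *)
Definition polytope_face (R : realType) (n : nat) (A F : set 'rV[R]_n) : Prop :=
  F !=set0 /\ exists l : 'cV[R]_n,
    F = [set p | A p /\ forall q, A q -> (q *m l) 0 0 <= (p *m l) 0 0].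

(* The faces of the cell c form the poset of nonempty faces of a polytope. *)
Definition polytopal_cell (R : realType) (C : Type) (le : C -> C -> Prop)
    (c : C) : Prop :=
  exists (n : nat) (A : set 'rV[R]_n) (phi : C -> set 'rV[R]_n),
    [/\ finite_set A,
        forall F, polytope_face A F <-> exists2 d, le d c & phi d = F
      & forall d e, le d c -> le e c -> (le d e <-> phi d `<=` phi e)].

(* A regular CW complex with polytopes as cells, given by its face poset,
   which determines it up to cellular homeomorphism: [face d c] says that the
   cell d lies in the closure of the cell c. The empty face is not a cell, and
   the complex may be infinite. *)
Record complex (R : realType) := Complex {
  cell :> Type;
  face : cell -> cell -> Prop;
  face_refl : forall c, face c c;
  face_anti : forall c d, face c d -> face d c -> c = d;
  face_trans : forall c d e, face c d -> face d e -> face c e;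
  face_polytopal : forall c, polytopal_cell R face c }.

(* Simple homotopy types are those of finite complexes. For infinite ones even
   the homotopy types of Hom(G x H, K) and Hom(G, K^H) may differ: if G is a
   point, H is infinite and both are edgeless, and K has at least two vertices,
   the former is a disconnected weak product of simplices, the latter a simplex. *)
Definition finite_complex (R : realType) (X : complex R) : Prop :=
  finite_set [set: X].

Definition complex_iso (R : realType) (X Y : complex R) : Prop :=
  exists i : X -> Y,
    (forall a b, face a b <-> face (i a) (i b)) /\ (forall y, exists x, i x = y).

(* Y is X with a free face s and the cell t removed, t being the only cell
   having s as a proper face. It follows that t is a maximal cell and that
   dim s = dim t - 1. The map i is the inclusion of Y into X, so that Y is only
   specified up to isomorphism. *)
Definition elementary_collapse (R : realType) (X Y : complex R) : Prop :=
  exists (s t : X) (i : Y -> X),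
    [/\ s <> t /\ face s t,
        forall r, face s r -> r = s \/ r = t,
        forall a b, face a b <-> face (i a) (i b)
      & forall r, (exists a, i a = r) <-> r <> s /\ r <> t].

(* X and Y are related by a formal deformation: a finite sequence of elementary
   collapses and elementary expansions, taken up to isomorphism. *)
Definition simple_homotopy_equivalent (R : realType) : complex R -> complex R -> Prop :=
  clos_refl_sym_trans (complex R)
    (fun X Y => complex_iso X Y \/ elementary_collapse X Y).

Record is_hom_cell (T G : graph) (eta : T -> set G) : Prop := IsHomCell {
  hom_cell_neq0 : forall x, eta x !=set0;
  hom_cell_fin : forall x, finite_set (eta x);
  hom_cell_weak : finite_set [set x | exists u v, [/\ eta x u, eta x v & u <> v]];
  hom_cell_edge : forall x y, edge x y ->
    forall u v, eta x u -> eta y v -> edge u v }.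

Definition hom_cell (T G : graph) := {eta : T -> set G | is_hom_cell eta}.

Definition hom_face (T G : graph) (d e : hom_cell T G) : Prop :=
  forall x, sval d x `<=` sval e x.

Lemma hom_face_refl (T G : graph) (c : hom_cell T G) : hom_face c c.
Proof. by move=> x. Qed.

Lemma hom_face_anti (T G : graph) (c d : hom_cell T G) :
  hom_face c d -> hom_face d c -> c = d.
Proof.
case: c d => [c cP] [d dP] cd dc; apply: eq_exist.
by apply/funext => x; apply/seteqP; split; [exact: cd|exact: dc].
Qed.

Lemma hom_face_trans (T G : graph) (c d e : hom_cell T G) :
  hom_face c d -> hom_face d e -> hom_face c e.
Proof. by move=> cd de x; apply: subset_trans (cd x) (de x). Qed.

Lemma sum_argmax (R : realType) (T V : eqType) (eta : T -> set V) (xs : seq T)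
    (w : T -> V -> R) (f : T -> V) :
  uniq xs -> (forall x, eta x (f x)) ->
  (forall g, (forall x, eta x (g x)) ->
     \sum_(x <- xs) w x (g x) <= \sum_(x <- xs) w x (f x)) <->
  (forall x, x \in xs -> forall v, eta x v -> w x v <= w x (f x)).
Proof.
move=> uxs etaf; split=> [fmax x xxs v etav|fmax g etag]; last first.
  by rewrite big_seq [leRHS]big_seq; apply: ler_sum => x xxs; exact: fmax.
pose g y := if y == x then v else f y.
have etag y : eta y (g y) by rewrite /g; case: eqP => [->|].
have := fmax g etag.
rewrite (bigD1_seq x)//= [leRHS](bigD1_seq x)//= {1}/g eqxx.
rewrite (eq_bigr (fun y => w y (f y))) ?lerD2r// => y /negPf yx.
by rewrite /g yx.
Qed.

Lemma finite_argmax (R : realType) (V : eqType) (A : set V) (w : V -> R) :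
  finite_set A -> A !=set0 -> exists2 u, A u & forall v, A v -> w v <= w u.
Proof.
move=> /finite_seqP[s ->]; elim: s => [[]//|a s IHs _].
case: s IHs => [_|b s IHs].
  by exists a; rewrite /= ?inE// => v; rewrite /= inE => /eqP ->.
have [|u us umax] := IHs; first by exists b; rewrite /= mem_head.
have [ua|au] := leP (w a) (w u).
  exists u => [/=|v /=]; first by rewrite in_cons us orbT.
  by rewrite in_cons => /orP[/eqP ->//|/umax].
exists a => [/=|v /=]; first by rewrite mem_head.
by rewrite in_cons => /orP[/eqP ->//|/umax/le_trans]; apply; exact: ltW.
Qed.

Lemma simplex_prod_faces (R : realType) (T V : eqType) (eta : T -> set V) :
    (forall x, eta x !=set0) -> (forall x, finite_set (eta x)) ->
    finite_set [set x | exists u v, [/\ eta x u, eta x v & u <> v]] ->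
  exists (n : nat) (A : set 'rV[R]_n) (phi : (T -> set V) -> set 'rV[R]_n),
    [/\ finite_set A,
        forall F, polytope_face A F <->
          exists2 d, forall x, d x !=set0 /\ d x `<=` eta x & phi d = F
      & forall d e, (forall x, d x !=set0 /\ d x `<=` eta x) ->
          (forall x, e x !=set0 /\ e x `<=` eta x) ->
          ((forall x, d x `<=` e x) <-> phi d `<=` phi e)].
Proof.
move=> eta0 etafin; set N := [set x | _] => Nfin.
have Dfin : finite_set [set p : T * V | N p.1 /\ eta p.1 p.2].
  apply: (@sub_finite_set _ _ (\bigcup_(x in N) (pair x @` eta x))).
    by move=> [x v] [/= Nx etaxv]; exists x => //; exists v.
  by apply: bigcup_finite => // x _; exact: finite_image.
move: Nfin => /finite_seqP[xs0 NE]; pose xs := undup xs0.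
have xsP x : reflect (N x) (x \in xs).
  by rewrite mem_undup; apply: (iffP idP); rewrite NE.
have uxs : uniq xs by exact: undup_uniq.
move: Dfin => /finite_seqP[s0 DE]; pose s := undup s0.
have sP x v : ((x, v) \in s) = (x \in xs) && `[< eta x v >].
  rewrite mem_undup; apply/idP/andP => [xvs|[/xsP Nx /asboolP xv]].
    have : [set` s0] (x, v) by [].
    by rewrite -DE => -[/= Nx xv]; split; [exact/xsP|exact/asboolP].
  have : [set p : T * V | N p.1 /\ eta p.1 p.2] (x, v) by [].
  by rewrite DE.
have us : uniq s by exact: undup_uniq.
have sing x : x \notin xs -> forall u v, eta x u -> eta x v -> u = v.
  move=> /negP xxs u v xu xv; apply/eqP/negPn/negP => /eqP uv.
  by apply: xxs; apply/xsP; exists u, v.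
pose tp := in_tuple s; pose n := size s.
pose pt (f : T -> V) : 'rV[R]_n :=
  \row_i (f (tnth tp i).1 == (tnth tp i).2)%:R.
pose sel (d : T -> set V) : set (T -> V) := [set f | forall x, d x (f x)].
pose W (l : 'cV[R]_n) x v := \sum_(i < n | tnth tp i == (x, v)) l i 0.
have ptW f l : (forall x, eta x (f x)) ->
    (pt f *m l) 0 0 = \sum_(x <- xs) W l x (f x).
  move=> etaf; rewrite mxE /W.
  under [RHS]eq_bigr do rewrite big_mkcond /=.
  rewrite exchange_big /=; apply: eq_bigr => i _; rewrite mxE.
  case E : (tnth tp i) => [x v] /=.
  have xvs : (x, v) \in s by rewrite -E mem_tnth.
  have xxs : x \in xs by move: xvs; rewrite sP => /andP[].
  rewrite (bigD1_seq x)//= big1 ?addr0.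
    by rewrite xpair_eqE eqxx eq_sym /=; case: eqP; rewrite ?mul1r ?mul0r.
  by move=> y yx; rewrite xpair_eqE eq_sym (negPf yx).
have selX (d : T -> set V) x v :
    (forall x, d x !=set0) -> d x v -> exists2 f, sel d f & f x = v.
  move=> d0 xv; have [f df] := choice d0.
  exists (fun y => if y == x then v else f y); last by rewrite eqxx.
  by move=> y; case: eqP => [->|].
have ptI f g x : (forall x, eta x (f x)) -> (forall x, eta x (g x)) ->
    pt f = pt g -> f x = g x.
  move=> etaf etag fg; case: (boolP (x \in xs)) => xxs; last exact: sing xxs _ _ _ _.
  have xs' : (x, f x) \in s by rewrite sP xxs; apply/asboolP.
  have /tnthP[i Ei] : (x, f x) \in tp by [].
  have := congr1 (fun p : 'rV[R]_n => p 0 i) fg.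
  rewrite !mxE -Ei /= eqxx; case: eqP => [->//|_] /eqP.
  by rewrite oner_eq0.
pose A := [set pt f | f in sel eta].
pose phi d := [set pt f | f in sel d].
have faceE l (d : T -> set V) : (forall x, d x !=set0 /\ d x `<=` eta x) ->
    (forall x, x \in xs -> forall v, eta x v ->
       (d x v <-> forall u, eta x u -> W l x u <= W l x v)) ->
    phi d = [set p | A p /\ forall q, A q -> (q *m l) 0 0 <= (p *m l) 0 0].
  move=> dP dW; apply/seteqP; split=> [_ [f df <-]|_ [[f etaf <-] fmax]].
    have etaf x : eta x (f x) by apply: (dP x).2.
    split; first by exists f.
    move=> _ [g etag <-]; rewrite !ptW//.
    have [_] := sum_argmax (W l) uxs etaf; apply => // x xxs.
    exact/dW.
  exists f => // x; case: (boolP (x \in xs)) => xxs.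
    apply/dW => //.
    have [+ _] := sum_argmax (W l) uxs etaf; apply=> // g etag.
    by rewrite -!ptW//; apply: fmax; exists g.
  have [[v dv] deta] := dP x.
  by rewrite (sing _ xxs (f x) v)//; exact: deta.
exists n, A, phi; split.
- apply: (@sub_finite_set _ _
    (range (fun b : {ffun 'I_n -> bool} => \row_i (b i)%:R : 'rV[R]_n))).
    move=> _ [f _ <-].
    exists [ffun i => f (tnth tp i).1 == (tnth tp i).2] => //.
    by apply/rowP => i; rewrite !mxE ffunE.
  exact: finite_image.
- move=> F; split=> [[[p Fp] [l FE]]|[d dP <-]].
    exists (fun x => if x \in xs then
        [set v | eta x v /\ forall u, eta x u -> W l x u <= W l x v] else eta x).
      move=> x; case: ifP => _; split => //; last by move=> v [].
      by have [v xv vmax] := finite_argmax (W l x) (etafin x) (eta0 x); exists v.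
    rewrite FE; apply: faceE => [x|x -> v xv].
      case: ifP => _; split => //; last by move=> v [].
      by have [v xv vmax] := finite_argmax (W l x) (etafin x) (eta0 x); exists v.
    by split=> [[]|].
  split.
    have [f df] := choice (fun x => (dP x).1).
    by exists (pt f), f.
  pose l : 'cV[R]_n := \col_i `[< d (tnth tp i).1 (tnth tp i).2 >]%:R.
  exists l; apply: faceE => // x xxs v xv.
  have WE u : eta x u -> W l x u = `[< d x u >]%:R.
    move=> xu; have xus : (x, u) \in s by rewrite sP xxs; apply/asboolP.
    have /tnthP[i Ei] : (x, u) \in tp by [].
    rewrite /W (big_pred1 i) ?mxE -?Ei// => j; rewrite Ei.
    apply/eqP/eqP => [|->//]; apply: tuple_uniqP => //.
  split=> [dv u xu|vmax].
    by rewrite !WE// (asboolT dv); case: asboolP => _; rewrite ?ler01 ?lexx.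
  have [[u du] deta] := dP x.
  have := vmax u (deta u du); rewrite !WE//; last exact: deta.
  by rewrite (asboolT du); case: asboolP => //; rewrite ler10.
- move=> d e dP eP; split=> [de _ [f df <-]|de x v dv].
    by exists f => // x; exact: de.
  have [f df fx] := selX d x v (fun x => (dP x).1) dv.
  have /de [g eg gf] : phi d (pt f) by exists f.
  rewrite -fx -(ptI g f x) => [||y|//]; first exact: eg.
    by move=> y; apply: (eP y).2.
  by apply: (dP y).2.
Qed.

Lemma hom_face_polytopal (R : realType) (T G : graph) (c : hom_cell T G) :
  polytopal_cell R (@hom_face T G) c.
Proof.
case: c => eta etaP.
have [n [A [phi [Afin AF phile]]]] := @simplex_prod_faces R
  {classic T} {classic G} eta (hom_cell_neq0 etaP)
  (hom_cell_fin etaP) (hom_cell_weak etaP).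
have sub (d : hom_cell T G) : hom_face d (exist _ eta etaP) ->
    forall x, sval d x !=set0 /\ sval d x `<=` eta x.
  by case: d => d dP /= de x; split; [exact: hom_cell_neq0 dP x|exact: de].
exists n, A, (fun d => phi (sval d)); split => //.
  move=> F; split=> [/AF[d dP <-]|[d /sub dP <-]]; last by apply/AF; exists (sval d).
  suff dcell : is_hom_cell d.
    by exists (exist _ d dcell) => // x; exact: (dP x).2.
  split=> [x|x||x y xy u v xu yv].
  - exact: (dP x).1.
  - exact: sub_finite_set (dP x).2 (hom_cell_fin etaP x).
  - apply: sub_finite_set (hom_cell_weak etaP) => x [u [v [du dv uv]]].
    by exists u, v; split => //; apply: (dP x).2.
  - by apply: (hom_cell_edge etaP xy); [exact: (dP x).2|exact: (dP y).2].
by move=> d e /sub dP /sub eP; exact: phile.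
Qed.

Definition Hom (R : realType) (T G : graph) : complex R :=
  Complex (@hom_face_refl T G) (@hom_face_anti T G) (@hom_face_trans T G)
    (@hom_face_polytopal R T G).

Lemma finite_Hom (R : realType) (T G : graph) :
  finite_set [set: T] -> finite_set [set: G] -> finite_complex (Hom R T G).
Proof.
move=> /(@finite_seqP {classic T})[s sE] /(@finite_seqP {classic G})[r rE].
pose code (d : Hom R T G) : {ffun 'I_(size s) * 'I_(size r) -> bool} :=
  [ffun p => `[< sval d (tnth (in_tuple s) p.1) (tnth (in_tuple r) p.2) >]].
rewrite /finite_complex (_ : setT = code @^-1` setT)//.
apply: finite_preimage => // -[d dP] [e eP] _ _ /ffunP de.
apply: eq_exist; apply/funext => x; apply/funext => v; apply/propext.
have /tnthP[i ->] : (x : {classic T}) \in in_tuple s.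
  by have : [set` s] x by rewrite -sE.
have /tnthP[j ->] : (v : {classic G}) \in in_tuple r.
  by have : [set` r] v by rewrite -rE.
have := de (i, j); rewrite !ffunE /= => deij; exact: (asbool_eq_equiv deij).
Qed.

(* Main.v *)
(** A cell [c] of X = Hom(G x H, K) and a cell [t] of Y = Hom(G, K^H) are
compatible if some cell [z] of X satisfies [c <= z] and [t <= power_cell z],
where [power_cell z x] consists of the maps f with [f y] in [z (x, y)] for all y.
The pairs of compatible cells form, together with X and Y, a subcomplex W of the
join of X and Y. It collapses to X: the cells of X compatible with a fixed [t]
are star-shaped around any vertex [v] of the cell [prod_cell t], hence, together
with the empty cell, they can be removed by elementary collapses, toggling [v x]
in [c x] one coordinate at a time, and this is done for every [t], starting with
the maximal ones. In the same way W collapses to Y. *)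

From mathcomp Require Import all_boot all_order all_algebra.
From mathcomp Require Import all_classical reals.
From Stdlib Require Import Relation_Operators.
Require Import Defs.

Set Implicit Arguments.
Unset Strict Implicit.
Unset Printing Implicit Defensive.

Import Order.TTheory GRing.Theory Num.Theory.

Local Open Scope classical_set_scope.
Local Open Scope ring_scope.

(** * Finite sets: induction and maximal elements *)

(** A strict subset of [A] misses some [a]; deleting [a] from a list covering [A] gives a shorter
    list covering the subset, so induction on the length applies. *)
Lemma finite_set_ind (T : Type) (P : set T -> Prop) :
  (forall A, finite_set A -> (forall B, B `<` A -> P B) -> P A) ->
  forall A, finite_set A -> P A.
Proof.
move=> IH A Afin.
have /(@finite_seqP {classic T})[s As] := Afin.
have {As} : A `<=` [set` s] by rewrite As.
have [n] := ubnP (size s); elim: n => // n IHn in A Afin s * => sn As.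
apply: IH => // B [BA /existsNP[a /not_implyP[Aa Ba]]].
apply: (IHn _ (sub_finite_set BA Afin) (@rem {classic T} a s)).
  have sa : (a : {classic T}) \in s by exact: As.
  rewrite size_rem//; case: (s) sa sn => //.
move=> b Bb /=.
have : (b : {classic T}) \in s by apply/As/BA.
have /perm_mem -> : perm_eq s (a :: rem (a : {classic T}) s).
  by apply/perm_to_rem/As.
by rewrite inE => /orP[/eqP ba|//]; rewrite ba in Bb.
Qed.

Lemma finite_set_maximal (T : Type) (le : T -> T -> Prop) (A : set T) :
    (forall a b c, le a b -> le b c -> le a c) ->
    (forall a b, le a b -> le b a -> a = b) ->
    finite_set A -> A !=set0 ->
  exists2 m, A m & forall a, A a -> le m a -> a = m.
Proof.
move=> trans anti; elim/finite_set_ind: A / => A _ IH [a Aa].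
have [|amax] := pselect (exists b, [/\ A b, le a b & b <> a]); last first.
  exists a => // b Ab ab; apply: contrapT => ba.
  by apply: amax; exists b.
move=> [b [Ab ab ba]].
have [||m [Am am ma] mmax] := IH [set b | [/\ A b, le a b & b <> a]].
- by split=> [c []//|/(_ a Aa)[]].
- by exists b.
exists m => // c Ac mc; apply: mmax => //; split=> //; first exact: trans mc.
by move=> ca; apply: ma; apply: anti; rewrite // -ca.
Qed.

(** * Collapses of finite posets *)

(** Stated for subsets of an ordered type instead of complexes, so that the empty cell can be one of
    the two removed elements. *)
Definition collapse_step (T : Type) (le : T -> T -> Prop) (A B : set T) : Prop :=
  exists s t, [/\ A s /\ A t, s <> t /\ le s t,
    forall r, A r -> le s r -> r = s \/ r = t & B = A `\` [set s; t]].

Definition collapses (T : Type) (le : T -> T -> Prop) : set T -> set T -> Prop :=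
  clos_refl_trans (set T) (collapse_step le).

(** No element of [S] lies above an image point, so a free pair of [A] stays free after [S] is
    added. *)
Lemma collapses_image (T U : Type) (leT : T -> T -> Prop) (leU : U -> U -> Prop)
    (f : T -> U) (S : set U) (A B : set T) :
    injective f -> (forall a b, leU (f a) (f b) <-> leT a b) ->
    (forall a, leT a a) -> (forall a r, leU (f a) r -> ~ S r) ->
  collapses leT A B -> collapses leU (S `|` f @` A) (S `|` f @` B).
Proof.
move=> finj fle refl Sf; elim=> [{}A {}B [s [t [[As At] [st sle] smax ->]]]|C|C D E _ + _].
- apply: rt_step; exists (f s), (f t); split.
  + by split; right; [exists s|exists t].
  + by split; [move/finj|apply/fle].
  + move=> r [Sr /Sf//|[a Aa <-] /fle/(smax _ Aa)[->|->]]; [by left|by right].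
  + apply/seteqP; split=> [r|r [[Sr|[a Aa <-]] rst]].
    * case=> [Sr|[a [Aa ast] <-]]; last first.
        split; first by right; exists a.
        by case=> /finj ?; apply: ast; [left|right].
      split; first by left.
      by case=> E; move: Sr; rewrite /= E; apply: (Sf s); apply/fle.
    * by left.
    * right; exists a => //; split=> // -[] aE; apply: rst; rewrite aE; first by left.
      by right.
- exact: rt_refl.
- exact: rt_trans.
Qed.

(** * Joins *)

(* [None] is the empty cell. *)
Definition opt_face (R : realType) (X : complex R) (c d : option X) : Prop :=
  match c, d with
  | None, _ => True
  | Some _, None => False
  | Some a, Some b => face a b
  end.

Lemma opt_face_refl (R : realType) (X : complex R) (c : option X) : opt_face c c.
Proof. by case: c => //= a; exact: face_refl. Qed.

Lemma opt_face_anti (R : realType) (X : complex R) (c d : option X) :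
  opt_face c d -> opt_face d c -> c = d.
Proof. by case: c d => [a|] [b|] //= ab ba; rewrite (face_anti ab ba). Qed.

Lemma opt_face_trans (R : realType) (X : complex R) (c d e : option X) :
  opt_face c d -> opt_face d e -> opt_face c e.
Proof. by case: c d e => [a|] [b|] [c|] //=; exact: face_trans. Qed.

(** * Polytopes of the cells of a join *)

Lemma polytope_face_sub (R : realType) (n : nat) (A F : set 'rV[R]_n) :
  polytope_face A F -> F `<=` A.
Proof. by case=> _ [l ->] p []. Qed.

(** A face of a join may meet only one of the two polytopes, so each factor must also offer the
    empty trace; it is assigned to [None]. *)
Lemma opt_face_polytopal (R : realType) (X : complex R) (c : option X) :
  exists (n : nat) (A : set 'rV[R]_n) (phi : option X -> set 'rV[R]_n),
    [/\ finite_set A,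
        forall F, F = set0 \/ polytope_face A F <->
          exists2 d, opt_face d c & phi d = F,
        forall d e, opt_face d c -> opt_face e c ->
          (opt_face d e <-> phi d `<=` phi e)
      & phi None = set0].
Proof.
case: c => [c|]; last first.
  exists 0%N, set0, (fun=> set0); split=> //.
  - move=> F; split=> [[->|Fface]|[d _ <-]]; [by exists None| |by left].
    by have [[p Fp] _] := Fface; have := polytope_face_sub Fface Fp.
  - by move=> [d|] [e|]; split=> //= _; exact: subset_refl.
have [n [A [phi [Afin AF phile]]]] := face_polytopal c.
exists n, A, (fun d => if d is Some d then phi d else set0); split=> //.
- move=> F; split=> [[->|/AF[d dc <-]]|[[d|] /= dc <-]].
  + by exists None.
  + by exists (Some d).
  + by right; apply/AF; exists d.
  + by left.
- move=> [d|] [e|] /= dc ec; first exact: phile.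
  - have [[p dp] _] : polytope_face A (phi d) by apply/AF; exists d.
    by split=> // /(_ p dp).
  - by split=> // _; exact: sub0set.
  - by split=> // _; exact: sub0set.
Qed.

(* The last coordinate separates the two polytopes and allows a linear form to
   have the same maximum on both. *)
Definition join_left (R : realType) (n m : nat) (p : 'rV[R]_n) : 'rV[R]_(n + (m + 1)) :=
  row_mx p 0.

Definition join_right (R : realType) (n m : nat) (q : 'rV[R]_m) : 'rV[R]_(n + (m + 1)) :=
  row_mx 0 (row_mx q 1%:M).

Lemma join_left_inj (R : realType) (n m : nat) : injective (@join_left R n m).
Proof. by move=> p p' /eq_row_mx[]. Qed.

Lemma join_right_inj (R : realType) (n m : nat) : injective (@join_right R n m).
Proof. by move=> q q' /eq_row_mx[_ /eq_row_mx[]]. Qed.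

Lemma join_left_right (R : realType) (n m : nat) (p : 'rV[R]_n) (q : 'rV[R]_m) :
  join_left m p <> join_right n q.
Proof.
move=> /eq_row_mx[_]; rewrite -row_mx0 => /eq_row_mx[_] /matrixP/(_ 0 0).
by rewrite !mxE => /eqP; rewrite eq_sym oner_eq0.
Qed.

Lemma join_left_form (R : realType) (n m : nat) (p : 'rV[R]_n) (l : 'cV[R]_(n + (m + 1))) :
  (join_left m p *m l) 0 0 = (p *m usubmx l) 0 0.
Proof. by rewrite -{1}(vsubmxK l) mul_row_col mul0mx addr0. Qed.

Lemma join_right_form (R : realType) (n m : nat) (q : 'rV[R]_m) (l : 'cV[R]_(n + (m + 1))) :
  (join_right n q *m l) 0 0 =
  (q *m usubmx (dsubmx l)) 0 0 + dsubmx (dsubmx l) 0 0.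
Proof.
rewrite -{1}(vsubmxK l) mul_row_col mul0mx add0r -{1}(vsubmxK (dsubmx l)).
by rewrite mul_row_col mul1mx mxE.
Qed.

Definition join_set (R : realType) (n m : nat) (A : set 'rV[R]_n) (B : set 'rV[R]_m) :
    set 'rV[R]_(n + (m + 1)) :=
  @join_left R n m @` A `|` @join_right R n m @` B.

Lemma join_set_left (R : realType) (n m : nat) (A : set 'rV[R]_n) (B : set 'rV[R]_m) p :
  join_set A B (join_left m p) <-> A p.
Proof.
split=> [[[p' Ap' /join_left_inj <-//]|[q _ E]]|Ap]; last by left; exists p.
by have := join_left_right (esym E).
Qed.

Lemma join_set_right (R : realType) (n m : nat) (A : set 'rV[R]_n) (B : set 'rV[R]_m) q :
  join_set A B (join_right n q) <-> B q.
Proof.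
split=> [[[p _ E]|[q' Bq' /join_right_inj <-//]]|Bq]; last by right; exists q.
by have := join_left_right E.
Qed.

Lemma join_set_subset (R : realType) (n m : nat) (A A' : set 'rV[R]_n) (B B' : set 'rV[R]_m) :
  join_set A B `<=` join_set A' B' <-> A `<=` A' /\ B `<=` B'.
Proof.
split=> [AB|[AA' BB']].
  by split=> [p Ap|q Bq]; [apply/(join_set_left _ B')/AB/join_set_left|
    apply/(join_set_right A')/AB/join_set_right].
by move=> _ [[p Ap <-]|[q Bq <-]]; [apply/join_set_left/AA'|apply/join_set_right/BB'].
Qed.

(** A form on the join restricts to a form on each side, up to a constant on the right. Conversely,
    forms cutting out [A'] and [B'] are combined with a weight [t] on the last coordinate, which
    shifts all values on the right copy: it equalises the two maxima, or separates them when one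
    side has to be avoided. *)
Lemma join_set_face (R : realType) (n m : nat) (A : set 'rV[R]_n) (B : set 'rV[R]_m)
    (F : set 'rV[R]_(n + (m + 1))) :
  polytope_face (join_set A B) F <->
  exists A' B', [/\ A' = set0 \/ polytope_face A A', B' = set0 \/ polytope_face B B',
    A' !=set0 \/ B' !=set0 & F = join_set A' B'].
Proof.
split=> [[[r0 Fr0] [l FE]]|[A' [B' [A'P B'P AB0 ->]]]].
  exists (@join_left R n m @^-1` F), (@join_right R n m @^-1` F); split.
  - have [->|/set0P[p0 Fp0]] := eqVneq (@join_left R n m @^-1` F) set0; first by left.
    right; split; first by exists p0.
    exists (usubmx l); move: Fp0; rewrite /preimage /= FE /= => -[] /join_set_left Ap0 p0max.
    apply/seteqP; split=> p /=.
      move=> [/join_set_left Ap pmax]; split=> // q Aq.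
      by rewrite -!(join_left_form (m := m)); apply/pmax/join_set_left.
    move=> [Ap pmax]; split; first exact/join_set_left.
    move=> r /p0max/le_trans; apply; rewrite !join_left_form; exact: pmax.
  - have [->|/set0P[p0 Fp0]] := eqVneq (@join_right R n m @^-1` F) set0; first by left.
    right; split; first by exists p0.
    exists (usubmx (dsubmx l)); move: Fp0.
    rewrite /preimage /= FE /= => -[] /join_set_right Ap0 p0max.
    apply/seteqP; split=> p /=.
      move=> [/join_set_right Ap pmax]; split=> // q Aq.
      have /pmax : join_set A B (join_right n q) by exact/join_set_right.
      by rewrite !join_right_form lerD2r.
    move=> [Ap pmax]; split; first exact/join_set_right.
    by move=> r /p0max/le_trans; apply; rewrite !join_right_form lerD2r; exact: pmax.
  - have : join_set A B r0 by move: Fr0; rewrite FE => -[].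
    by case=> -[p _ E]; [left|right]; exists p; rewrite /= E.
  - apply/seteqP; split=> r.
      move=> Fr; have : join_set A B r by move: Fr; rewrite FE => -[].
      by case=> -[p _ E]; [left|right]; exists p; rewrite //= E.
    by case=> -[p Fp <-].
split.
  by case: AB0 => -[p Ap]; [exists (join_left m p)|exists (join_right n p)];
    [apply/join_set_left|apply/join_set_right].
suff [l1 [l2 [t tP]]] : exists (l1 : 'cV[R]_n) (l2 : 'cV[R]_m) (t : R),
   (forall p, A' p <-> A p /\ (forall q, A q -> (q *m l1) 0 0 <= (p *m l1) 0 0) /\
      (forall q, B q -> (q *m l2) 0 0 + t <= (p *m l1) 0 0)) /\
   (forall p, B' p <-> B p /\ (forall q, A q -> (q *m l1) 0 0 <= (p *m l2) 0 0 + t) /\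
      (forall q, B q -> (q *m l2) 0 0 <= (p *m l2) 0 0)).
  pose l : 'cV[R]_(n + (m + 1)) := col_mx l1 (col_mx l2 t%:M).
  have lL p : (join_left m p *m l) 0 0 = (p *m l1) 0 0.
    by rewrite join_left_form /l col_mxKu.
  have lR p : (join_right n p *m l) 0 0 = (p *m l2) 0 0 + t.
    by rewrite join_right_form /l !col_mxKd col_mxKu [t%:M _ _]mxE.
  exists l; apply/seteqP; split.
    move=> _ [[p /tP.1[Ap [pA pB]] <-]|[p /tP.2[Bp [pA pB]] <-]]; split.
    - exact/join_set_left.
    - by move=> _ [[q Aq <-]|[q Bq <-]]; rewrite !(lL, lR); [exact: pA|exact: pB].
    - exact/join_set_right.
    - move=> _ [[q Aq <-]|[q Bq <-]]; rewrite !(lL, lR); first exact: pA.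
      by rewrite lerD2r; exact: pB.
  move=> r [[[p Ap <-]|[p Bp <-]] rmax].
    left; exists p => //; apply/tP.1; split=> //; split=> q Xq.
      by rewrite -!lL; apply/rmax/join_set_left.
    by rewrite -lL -lR; apply/rmax/join_set_right.
  right; exists p => //; apply/tP.2; split=> //; split=> q Xq.
    by rewrite -lL -lR; apply/rmax/join_set_left.
  by rewrite -(lerD2r t) -!lR; apply/rmax/join_set_right.
have zero k (p : 'rV[R]_k) : (p *m (0 : 'cV[R]_k)) 0 0 = 0 by rewrite mulmx0 mxE.
case: A'P B'P AB0 => [->|[A'0 [l1 A'E]]] [->|[B'0 [l2 B'E]]] AB0.
- by case: AB0 => -[].
- have [q0] := B'0; rewrite {1}B'E => -[Bq0 q0max].
  (* The right maximum becomes 1 while all left values are 0, so the face misses [A]. *)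
  exists 0, l2, (1 - (q0 *m l2) 0 0); split=> p; split=> //.
  + by case=> _ [_ /(_ _ Bq0)]; rewrite addrC subrK zero ler10.
  + rewrite B'E => -[Bp pmax]; split=> //; split=> // q _.
    by rewrite zero addrCA addr_ge0 ?subr_ge0 ?ler01//; exact: pmax.
  + by rewrite B'E => -[Bp [_ pmax]].
- have [p0] := A'0; rewrite {1}A'E => -[Ap0 p0max].
  (* The constant value on the right lies 1 below the left maximum, so the face misses [B]. *)
  exists l1, 0, ((p0 *m l1) 0 0 - 1); split=> p; split=> //.
  + rewrite A'E => -[Ap pmax]; split=> //; split=> // q _.
    rewrite zero add0r lerBlDr (le_trans (pmax _ Ap0))// lerDl; exact: ler01.
  + by rewrite A'E => -[Ap [pmax _]].
  + by case=> _ [/(_ _ Ap0)]; rewrite zero add0r lerBrDr gerDl ler10.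
- have [p0] := A'0; rewrite {1}A'E => -[Ap0 p0max].
  have [q0] := B'0; rewrite {1}B'E => -[Bq0 q0max].
  (* This shift makes the two maxima coincide. *)
  exists l1, l2, ((p0 *m l1) 0 0 - (q0 *m l2) 0 0); split=> p; split.
  + rewrite A'E => -[Ap pmax]; split=> //; split=> // q Bq.
    by rewrite addrCA (le_trans _ (pmax _ Ap0))// gerDl subr_le0; exact: q0max.
  + by rewrite A'E => -[Ap [pmax _]].
  + rewrite B'E => -[Bp pmax]; split=> //; split=> // q Aq.
    by rewrite addrCA (le_trans (p0max _ Aq))// lerDl subr_ge0; exact: pmax.
  + by rewrite B'E => -[Bp [_ pmax]].
Qed.

(** * Subcomplexes of a join and their collapses *)

Definition pair_face (R : realType) (X Y : complex R) (p q : option X * option Y) : Prop :=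
  opt_face p.1 q.1 /\ opt_face p.2 q.2.

(* The cells of the join X * Y are the pairs of possibly empty cells of X and
   Y, except for [(None, None)], which is the empty cell of the join. *)
Record is_join_subcomplex (R : realType) (X Y : complex R) (S : set (option X * option Y)) :
    Prop := IsJoinSubcomplex {
  join_subcomplex_neq0 : ~ S (None, None);
  join_subcomplex_down : forall p q, S q -> pair_face p q -> p <> (None, None) -> S p }.

Definition join_cell (R : realType) (X Y : complex R) (S : set (option X * option Y)) :=
  {p | S p}.

Definition join_face (R : realType) (X Y : complex R) (S : set (option X * option Y))
    (p q : join_cell S) : Prop :=
  pair_face (sval p) (sval q).

Lemma pair_face_refl (R : realType) (X Y : complex R) (p : option X * option Y) :
  pair_face p p.
Proof. by split; exact: opt_face_refl. Qed.

Lemma join_face_refl (R : realType) (X Y : complex R) (S : set (option X * option Y))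
  (p : join_cell S) : join_face p p.
Proof. exact: pair_face_refl. Qed.

Lemma join_face_anti (R : realType) (X Y : complex R) (S : set (option X * option Y))
  (p q : join_cell S) : join_face p q -> join_face q p -> p = q.
Proof.
case: p q => [[a b] ab] [[c d] cd] [/= ac bd] [/= ca db]; apply: eq_exist.
by rewrite (opt_face_anti ac ca) (opt_face_anti bd db).
Qed.

Lemma join_face_trans (R : realType) (X Y : complex R) (S : set (option X * option Y))
  (p q r : join_cell S) : join_face p q -> join_face q r -> join_face p r.
Proof.
by move=> [pq1 pq2] [qr1 qr2]; split; [exact: opt_face_trans qr1|exact: opt_face_trans qr2].
Qed.

(** The polytope of [(a, b)] is the join of those of [a] and [b]. Downward closure of [S] provides
    all its nonempty faces, and only [(None, None)], which is not in [S], would have an empty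
    trace. *)
Lemma join_face_polytopal (R : realType) (X Y : complex R)
    (S : set (option X * option Y)) (p : join_cell S) :
  is_join_subcomplex S -> polytopal_cell R (@join_face R X Y S) p.
Proof.
case: p => [[a b] ab] SC.
have [n [A [phi [Afin AF phile phi0]]]] := opt_face_polytopal a.
have [m [B [psi [Bfin BF psile psi0]]]] := opt_face_polytopal b.
exists (n + (m + 1))%N, (join_set A B), (fun d => join_set (phi (sval d).1) (psi (sval d).2)).
split.
- by rewrite /join_set finite_setU; split; exact: finite_image.
- move=> F; rewrite join_set_face; split.
    move=> [A' [B' [/AF[c ca <-] /BF[d db <-] cd0 ->]]].
    have Scd : S (c, d).
      apply: join_subcomplex_down ab _ _ => //; case=> ? ?; subst.
      by rewrite phi0 psi0 in cd0; case: cd0 => -[].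
    by exists (exist _ (c, d) Scd).
  move=> [[[c d] cd] [/= ca db] <-]; exists (phi c), (psi d); split=> //.
  + by apply/AF; exists c.
  + by apply/BF; exists d.
  + case: c d cd ca db => [c|] d cd ca db.
      left; apply/set0P/eqP => c0.
      have /(phile _ None ca) /= : phi (Some c) `<=` phi None by rewrite c0.
      exact.
    case: d cd db => [d|] cd db; last by case: SC => /(_ cd).
    right; apply/set0P/eqP => d0.
    have /(psile _ None db) /= : psi (Some d) `<=` psi None by rewrite d0.
    exact.
- move=> [[c d] cd] [[c' d'] cd'] [/= ca db] [/= c'a d'b].
  rewrite join_set_subset /join_face /pair_face /=.
  by rewrite phile // psile.
Qed.

Definition join_complex (R : realType) (X Y : complex R) (S : set (option X * option Y))
    (SC : is_join_subcomplex S) : complex R :=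
  Complex (@join_face_refl R X Y S) (@join_face_anti R X Y S) (@join_face_trans R X Y S)
    (fun p => join_face_polytopal p SC).

(** A cell of [S] above [s] or [t] is above [s], hence is one of the two; so no remaining cell loses
    a face. *)
Lemma is_join_subcomplex_collapse (R : realType) (X Y : complex R)
    (S S' : set (option X * option Y)) :
  is_join_subcomplex S -> collapse_step (@pair_face R X Y) S S' -> is_join_subcomplex S'.
Proof.
move=> SC [s [t [[Ss St] [st sle] smax ->]]]; split=> [[/(join_subcomplex_neq0 SC)//]|].
move=> p q [Sq qst] pq p0; split; first exact: join_subcomplex_down Sq pq p0.
have qs : pair_face s q -> False.
  by move=> /(smax _ Sq)[] ?; apply: qst; [left|right].
case=> pE; apply: qs; first by rewrite -pE.
rewrite pE in pq; have [s1 s2] := sle; have [t1 t2] := pq.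
by split; [exact: opt_face_trans t1|exact: opt_face_trans t2].
Qed.

Lemma join_collapses (R : realType) (X Y : complex R) (S S' : set (option X * option Y)) :
    collapses (@pair_face R X Y) S S' -> forall SC : is_join_subcomplex S,
  exists SC' : is_join_subcomplex S',
    simple_homotopy_equivalent (join_complex SC) (join_complex SC').
Proof.
elim=> [{}S {}S' SS' SC|{}S SC|S1 S2 S3 _ IH1 _ IH2 SC1]; last first.
- have [SC2 S12] := IH1 SC1; have [SC3 S23] := IH2 SC2.
  by exists SC3; apply: rst_trans S23.
- by exists SC; exact: rst_refl.
exists (is_join_subcomplex_collapse SC SS'); apply: rst_step; right.
have [s [t [[Ss St] [st sle] smax S'E]]] := SS'.
have S'S p : S' p -> S p by rewrite S'E => -[].
exists (exist _ s Ss), (exist _ t St), (fun p => exist _ (sval p) (S'S _ (svalP p))); split.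
- by split=> // -[].
- by move=> [r Sr] /= /(smax _ Sr)[] ?; [left|right]; exact: eq_exist.
- by [].
- move=> [r Sr]; split=> [[[a S'a] <-]|[rs rt]].
    have [_ ast] : (S `\` [set s; t]) a by rewrite -S'E.
    by split=> -[aE]; apply: ast; [left|right].
  suff S'r : S' r by exists (exist _ r S'r); exact: eq_exist.
  by rewrite S'E; split=> // -[] rE; [apply: rs|apply: rt]; exact: eq_exist.
Qed.

Definition join_over (R : realType) (X Y : complex R) (C : X -> Y -> Prop) :
    set (option X * option Y) :=
  [set p | match p with
           | (None, None) => False
           | (Some a, Some b) => C a b
           | _ => True
           end].

Lemma join_over_subcomplex (R : realType) (X Y : complex R) (C : X -> Y -> Prop) :
    (forall a a' b b', C a b -> face a' a -> face b' b -> C a' b') ->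
  is_join_subcomplex (join_over C).
Proof.
move=> CC; split=> // -[[a'|] [b'|]] [[a|] [b|]] //= Cab [/= a'a b'b] p0 //.
exact: CC Cab a'a b'b.
Qed.

(** The fibre over a cell [b] of [Y] consists of the pairs with second component [Some b]. Its first
    components are [None] and the cells related to [b], which is the set assumed to collapse to
    [set0]. *)
Lemma join_over_collapses (R : realType) (X Y : complex R) (C : X -> Y -> Prop)
    (SC : is_join_subcomplex (join_over C)) :
    finite_complex Y ->
    (forall b, collapses (@opt_face R X) ([set None] `|` Some @` [set a | C a b]) set0) ->
  simple_homotopy_equivalent (join_complex SC) X.
Proof.
move=> Yfin Cb.
pose part (D : set Y) := [set p | join_over C p /\
  match p.2 with None => True | Some b => D b end].
have part_collapses D : finite_set D -> collapses (@pair_face R X Y) (part D) (part set0).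
  elim/finite_set_ind => {}D Dfin IH.
  have [->|/set0P D0] := eqVneq D set0; first exact: rt_refl.
  have [m Dm mmax] := finite_set_maximal (@face_trans R Y) (@face_anti R Y) Dfin D0.
  apply: rt_trans (IH (D `\ m) _); last first.
    by split=> [b []//|/(_ _ Dm)[_ /(_ erefl)]].
  (* The fibre over [m] is collapsed while [part (D \ m)] is kept. No pair of the latter lies above
     the fibre, because [m] is maximal in [D]. *)
  have := @collapses_image _ _ (@opt_face R X) (@pair_face R X Y)
    (fun a => (a, Some m)) (part (D `\ m)) _ _ _ _ _ _ (Cb m).
  rewrite image_set0 setU0; set S1 := _ `|` _; have -> : S1 = part D.
    apply/seteqP; split=> [p [[pC pD]|[a aC <-]]|[a [b|]] [/= pC bD]].
    - by split=> //; case: p.2 pD => // b [].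
    - by split=> //; case: aC => [->//|[c Cc <-]].
    - have [bm|bm] := pselect (b = m); last by left.
      right; exists a; last by rewrite bm.
      rewrite -bm; case: a pC => [a|_]; last by left.
      by right; exists a.
    - by left; split=> //; case: a pC.
  apply.
  - by move=> a b [].
  - by move=> a b; split=> [[]//|ab]; split=> //; exact: face_refl.
  - exact: opt_face_refl.
  - move=> a [c [b|]] [_ //= mb] [_ [/= Db]]; apply; exact: mmax.
have fullE : part setT = join_over C.
  by apply/seteqP; split=> [p []//|p Cp]; split=> //; case: p.2.
have := part_collapses _ Yfin; rewrite fullE => /join_collapses/(_ SC)[SC' SH].
apply: rst_trans SH _; apply/rst_sym/rst_step; left.
have part0 a : part set0 (Some a, None) by [].
exists (fun a => exist _ (Some a, None) (part0 a)); split.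
  by move=> a b; split=> [ab|[]].
move=> [[[a|] [b|]] pP]; try by case: (pP).
by exists a; exact: eq_exist.
Qed.

(* Both equivalences are collapses of the subcomplex [join_over C] of the join,
   which contains X and Y. *)
Lemma fibre_collapses_equivalent (R : realType) (X Y : complex R) (C : X -> Y -> Prop) :
    finite_complex X -> finite_complex Y ->
    (forall a a' b b', C a b -> face a' a -> face b' b -> C a' b') ->
    (forall b, collapses (@opt_face R X) ([set None] `|` Some @` [set a | C a b]) set0) ->
    (forall a, collapses (@opt_face R Y) ([set None] `|` Some @` [set b | C a b]) set0) ->
  simple_homotopy_equivalent X Y.
Proof.
move=> Xfin Yfin CC Cb Ca.
have SC := join_over_subcomplex CC.
(* The collapse onto [Y] is the collapse onto the first factor after exchanging the roles of [X] and
   [Y]. *)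
have SC' : is_join_subcomplex (join_over (fun b a => C a b)).
  by apply: join_over_subcomplex => b b' a a' Cab b'b a'a; exact: CC Cab a'a b'b.
apply: rst_trans (rst_sym _ _ _ _ (join_over_collapses SC Yfin Cb)) _.
apply: rst_trans (join_over_collapses SC' Xfin Ca).
apply: rst_step; left.
have swapP p : join_over C p -> join_over (fun b a => C a b) (p.2, p.1).
  by case: p => [[a|] [b|]].
exists (fun p => exist _ _ (swapP _ (svalP p))); split.
  by move=> p q; split=> -[].
move=> [[b a] ab]; have ba : join_over C (a, b) by case: a b ab => [a|] [b|].
by exists (exist _ _ ba); exact: eq_exist.
Qed.

(** * Hom complexes *)

Lemma is_hom_cell_sub (T G : graph) (d : T -> set G) (z : hom_cell T G) :
  (forall x, d x !=set0) -> (forall x, d x `<=` sval z x) -> is_hom_cell d.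
Proof.
case: z => z zP /= d0 dz; split=> // [x||x y xy u v /dz zu /dz zv].
- exact: sub_finite_set (dz x) (hom_cell_fin zP x).
- apply: sub_finite_set (hom_cell_weak zP) => x [u [v [/dz zu /dz zv uv]]].
  by exists u, v.
- exact: (hom_cell_edge zP xy).
Qed.

Lemma is_hom_cell_vertex (T G : graph) (v : T -> G) :
  (forall x y, edge x y -> edge (v x) (v y)) -> is_hom_cell (fun x => [set v x]).
Proof.
move=> vE; split=> [x|x||x y xy _ _ -> ->]; [by exists (v x)|exact: finite_set1| |exact: vE].
rewrite (_ : [set x | _] = set0)//; apply/seteqP; split=> // x [a [b [-> ->]]].
exact.
Qed.

(* A cell [c] with [v] not in [c x] is removed together with the cell obtained by
   adding [v] to [c x]. *)
Lemma collapses_coordinate (T G : graph) (F : set (hom_cell T G)) (x : T) (v : G) :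
    finite_set F ->
    (forall c d, F d -> hom_face c d -> F c) ->
    (forall c, F c -> exists2 d, F d &
       sval d = fun y => [set u | sval c y u \/ (y = x /\ u = v)]) ->
  collapses (@hom_face T G) F [set c | F c /\ sval c x `<=` [set v]].
Proof.
elim/finite_set_ind => {}F Ffin IH Fdown Fadd.
have rem_cell (c : hom_cell T G) :
    (exists2 u, sval c x u & u <> v) ->
    exists2 d, hom_face d c & sval d = fun y => [set u | sval c y u /\ (y = x -> u <> v)].
  move=> [u cu uv].
  have dP : is_hom_cell (fun y => [set u | sval c y u /\ (y = x -> u <> v)]).
    apply: (@is_hom_cell_sub _ _ _ c) => [y|y w []//].
    have [->|yx] := pselect (y = x); first by exists u.
    by have [w cw] := hom_cell_neq0 (svalP c) y; exists w; split.
  by exists (exist _ _ dP) => // y w [].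
have [[c0 c0P]|Fv] := pselect (exists c, F c /\ ~ sval c x v); last first.
  (* If every cell of [F] has [v] at [x], none has a second value there, since deleting [v] would
     give a cell of [F] without it. The target is then [F] itself. *)
  rewrite (_ : [set c | _] = F); first exact: rt_refl.
  apply/seteqP; split=> [c []//|c Fc]; split=> // u cu /=.
  apply: contrapT => uv; apply: Fv; have [|d dc dE] := rem_cell c; first by exists u.
  by exists d; split; [exact: Fdown dc|rewrite dE => -[_ /(_ erefl)]].
have [||s [Fs sv] smax] := finite_set_maximal (@hom_face_trans T G) (@hom_face_anti T G)
    (A := [set c | F c /\ ~ sval c x v]).
- by apply: sub_finite_set Ffin => c [].
- by exists c0.
have [t Ft tE] := Fadd s Fs.
have st : hom_face s t by move=> y u su; rewrite tE; left.
have tv : sval t x v by rewrite tE; right.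
(* If [r] has [v] at [x], deleting it gives a cell of [F] above [s] without [v], which is [s] by
   maximality; hence [r = t]. *)
have s_or_t r : F r -> hom_face s r -> r = s \/ r = t.
  move=> Fr sr; have [rv|rv] := pselect (sval r x v); last by left; exact: smax.
  have [u su] := hom_cell_neq0 (svalP s) x.
  have uv : u <> v by move=> uv; rewrite uv in su.
  have [|d dr dE] := rem_cell r; first by exists u => //; exact: sr.
  have ds : d = s.
    apply: smax; first by split; [exact: Fdown dr|rewrite dE => -[_ /(_ erefl)]].
    by move=> y w sw; rewrite dE; split; [exact: sr|move=> yx wv; subst].
  right; apply: hom_face_anti => y w.
    move=> rw; rewrite tE -ds dE /=.
    have [yxwv|yxwv] := pselect (y = x /\ w = v); [by right|left; split=> // yx wv].
    exact: yxwv.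
  by rewrite tE => -[/sr//|[-> ->]].
have nlast c : (exists2 u, sval c x u & u <> v) -> ~ sval c x `<=` [set v].
  by move=> [u cu uv] /(_ u cu).
have sx : exists2 u, sval s x u & u <> v.
  have [u su] := hom_cell_neq0 (svalP s) x.
  by exists u => // uv; rewrite uv in su.
have -> : [set c | F c /\ sval c x `<=` [set v]] =
    [set c | (F `\` [set s; t]) c /\ sval c x `<=` [set v]].
  apply/seteqP; split=> c [Fc cx]; last by split=> //; case: Fc.
  split=> //; split=> // -[] cE; rewrite cE in cx; apply: nlast cx => //.
  by have [u su uv] := sx; exists u => //; exact: st.
apply: rt_trans (IH (F `\` [set s; t]) _ _ _).
- apply: rt_step; exists s, t; split=> //; split=> // stE.
  by rewrite stE in sv.
- by split=> [c []//|/(_ _ Fs)[_]]; apply; left.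
- move=> c d [Fd dst] cd; split; first exact: Fdown cd.
  have sd : hom_face s d -> False.
    by move=> /(s_or_t _ Fd)[] ?; apply: dst; [left|right].
  case=> cE; rewrite cE in cd; apply: sd => //; exact: hom_face_trans cd.
(* Adding [v] never yields [s], and yields [t] only from [s] or [t], so the remaining cells are
   still closed under this addition. *)
- move=> c [Fc cst]; have [d Fd dE] := Fadd c Fc; exists d => //; split=> // -[] dst.
    by apply: sv; rewrite -dst dE; right.
  apply: cst; have [cv|cv] := pselect (sval c x v).
    right; rewrite -dst; apply: hom_face_anti => y u; rewrite dE; first by left.
    by case=> // -[-> ->].
  left; apply: hom_face_anti => y u.
    move=> cu; have : sval d y u by rewrite dE; left.
    by rewrite dst tE => -[//|[yx uv]]; subst.
  move=> su; have : sval d y u by rewrite dst; exact: st.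
  by rewrite dE => -[//|[yx uv]]; subst.
Qed.

(** * Star-shaped sets of cells *)

Definition star_shaped (T G : graph) (F : set (hom_cell T G)) (v : T -> G) : Prop :=
  forall c, F c -> exists z, [/\ hom_face c z, forall x, sval z x (v x)
    & forall d, hom_face d z -> F d].

(** Confining one coordinate [x] at a time to [v x] gives a smaller set that is again star-shaped.
    When no coordinate is left to confine, only the vertex [v] remains. *)
Lemma star_shaped_collapses (R : realType) (T G : graph) (F : set (hom_cell T G))
    (v : T -> G) :
    finite_set F -> F !=set0 -> star_shaped F v ->
  collapses (@opt_face R (Hom R T G)) ([set None] `|` Some @` F) set0.
Proof.
elim/finite_set_ind => {}F Ffin IH [c0 Fc0] Fstar.
have [b Fb bE] : exists2 b, F b & sval b = fun x => [set v x].
  have [z [_ zv zF]] := Fstar c0 Fc0.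
  have bP : is_hom_cell (fun x => [set v x]).
    by apply: (@is_hom_cell_sub _ _ _ z) => [x|x _ ->//]; exists (v x).
  by exists (exist _ _ bP) => //; apply: zF => x _ ->; exact: zv.
have Fdown c d : F d -> hom_face c d -> F c.
  move=> /Fstar[z [dz _ zF]] cd; apply: zF; exact: hom_face_trans dz.
have [[c [x [Fc cx]]]|Fv] := pselect (exists c x, F c /\ ~ sval c x `<=` [set v x]).
- apply: rt_trans (IH [set c | F c /\ sval c x `<=` [set v x]] _ _ _).
  + have lift := @collapses_image _ _ (@hom_face T G) (@opt_face R (Hom R T G)) Some
      [set None].
    apply: lift => [d e []//|//|d|d [e|]//|]; first exact: hom_face_refl.
    apply: collapses_coordinate => // d /Fstar[z [dz zv zF]].
      have eP : is_hom_cell (fun y => [set u | sval d y u \/ (y = x /\ u = v x)]).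
        apply: (@is_hom_cell_sub _ _ _ z) => [y|y u [/dz//|[-> ->]//]].
        by have [u du] := hom_cell_neq0 (svalP d) y; exists u; left.
      exists (exist _ _ eP) => //; apply: zF => y u [/dz//|[-> ->]//].
  + by split=> [d []//|/(_ _ Fc)[]].
  + by exists b; split=> //; rewrite bE.
  + move=> d [Fd dx]; have [z [dz zv zF]] := Fstar d Fd.
    (* The witness for [d] in the smaller set is the old witness [z] cut down to [v x] at [x]. *)
    have eP : is_hom_cell (fun y => [set u | sval z y u /\ (y = x -> u = v x)]).
      apply: (@is_hom_cell_sub _ _ _ z) => [y|y u []//].
      by exists (v y); split=> // ->.
    exists (exist _ _ eP); split=> [y u du|y|e ez] /=.
    * by split; [exact: dz|move=> yx; subst; exact: dx].
    * by split=> // ->.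
    * split; first by apply: zF => y u /ez[].
      by move=> u /ez[_]; apply.
- have Fb' c : F c -> c = b.
    move=> Fc; have cv x : sval c x `<=` [set v x].
      by apply: contrapT => cx; apply: Fv; exists c, x.
    apply: hom_face_anti => x u; rewrite bE; first exact: cv.
    have [w cw] := hom_cell_neq0 (svalP c) x.
    by move=> ->; rewrite -(cv _ _ cw).
  (* The last vertex is removed together with the empty cell. *)
  apply: rt_step; exists None, (Some b); split=> //.
  + by split; [left|right; exists b].
  + by move=> r [->|[c Fc <-]] _; [left|right; rewrite (Fb' c Fc)].
  + apply/seteqP; split=> // r [[->|[c Fc <-]] rb]; apply: rb; first by left.
    by right; rewrite (Fb' c Fc).
Qed.

Lemma finite_set_inj (T U : Type) (A : set T) (f : T -> U) :
  finite_set [set: U] -> (forall a b, A a -> A b -> f a = f b -> a = b) -> finite_set A.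
Proof.
move=> Ufin finj.
have fA : {in A &, injective f} by move=> a b /set_mem Aa /set_mem Ab; exact: finj.
by rewrite -(eq_finite_set (inj_card_eq fA)); exact: sub_finite_set Ufin.
Qed.

(** * Currying of cells *)

Definition power_cell (G H K : graph) (z : hom_cell (gprod G H) K) (x : G) :
    set (gpower K H) :=
  [set f | forall y, sval z (x, y) (f y)].

(** The maps in [power_cell z x] inject into the cells of Hom(G x H, K): overwrite a fixed vertex
    [v] of [z] over [x] by the given map. Two maps that differ do so at some [y], so a coordinate
    [x] with several maps is the projection of a coordinate [(x, y)] where [z] has several
    values. *)
Lemma is_hom_cell_power (R : realType) (G H K : graph) (z : hom_cell (gprod G H) K) :
  finite_complex (Hom R (gprod G H) K) -> is_hom_cell (power_cell z).
Proof.
move=> fin; have zP := svalP z.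
have [v zv] := choice (hom_cell_neq0 zP).
split=> [x|x||x x' xx' f g fz gz y y' yy'].
- by exists (fun y => v (x, y)) => y; exact: zv.
- pose g (f : gpower K H) (p : gprod G H) := if pselect (p.1 = x) then f p.2 else v p.
  have gcell f : exists c : hom_cell (gprod G H) K,
      power_cell z x f -> forall p, sval c p = [set g f p].
    (* Outside [power_cell z x] the cell [z] is only a default value. *)
    have [fz|nfz] := pselect (power_cell z x f); last by exists z.
    have cP : is_hom_cell (fun p => [set g f p]).
      apply: (@is_hom_cell_sub _ _ _ z) => [p|[x' y] _ ->]; first by exists (g f p).
      by rewrite /g; case: pselect => //= ->; exact: fz.
    by exists (exist _ _ cP).
  have [c cE] := choice gcell.
  apply: (finite_set_inj (f := c) fin) => f f' fz f'z ff'; apply/funext => y.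
  have : [set g f (x, y)] = [set g f' (x, y)] by rewrite -!cE// ff'.
  move=> /seteqP[/(_ _ erefl) + _]; rewrite /g /=.
  by case: pselect.
- apply: sub_finite_set (finite_image fst (hom_cell_weak zP)) => x [f [g [fz gz fg]]].
  have [y fgy] : exists y, f y <> g y.
    by apply: contrapT => /forallNP E; apply: fg; apply/funext => y; apply: contrapT.
  by exists (x, y) => //; exists (f y), (g y); split.
- by apply: (@hom_cell_edge _ _ _ zP (x, y) (x', y')).
Qed.

(** The least candidate for the cell [z] of compatibility: [t] lies in [power_cell z] exactly when
    [prod_cell t] lies in [z]. *)
Definition prod_cell (G H K : graph) (t : hom_cell G (gpower K H)) (p : gprod G H) : set K :=
  [set f p.2 | f in sval t p.1].

Lemma is_hom_cell_prod (R : realType) (G H K : graph) (t : hom_cell G (gpower K H)) :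
  finite_complex (Hom R G (gpower K H)) -> is_hom_cell (prod_cell t).
Proof.
move=> fin; have tP := svalP t.
have [w tw] := choice (hom_cell_neq0 tP).
have prod_edge x x' y y' : edge x x' -> edge y y' ->
    forall u u', prod_cell t (x, y) u -> prod_cell t (x', y') u' -> edge u u'.
  move=> xx' yy' _ _ [f tf <-] [g tg <-] /=.
  have fg : edge f g by exact: (hom_cell_edge tP xx').
  exact: fg.
split=> [[x y]|[x y]||[x y] [x' y'] [xx' yy']]; last exact: prod_edge.
- by exists (w x y), (w x).
- exact: finite_image (hom_cell_fin tP x).
set N := [set p | _].
(* Changing the vertex [w] of [t] at any single point of [N] gives again a
   vertex of Hom(G, K^H), and these vertices are distinct. *)
have /choice[c cE] (p : gprod G H) : exists c : hom_cell G (gpower K H), N p ->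
    exists a, a <> w p.1 p.2 /\ forall x, sval c x =
      [set (fun y => if pselect ((x, y) = p) then a else w x y)].
  have [[u [u' [tu tu' uu']]]|nNp] := pselect (N p); last by exists t.
  have [a ta aw] : exists2 a, prod_cell t p a & a <> w p.1 p.2.
    have [uw|] := pselect (u = w p.1 p.2); last by exists u.
    by exists u' => // u'w; apply: uu'; rewrite uw u'w.
  pose f (x : G) : gpower K H := fun y => if pselect ((x, y) = p) then a else w x y.
  have tf x y : prod_cell t (x, y) (f x y).
    by rewrite /f; case: pselect => [e|_] /=; [rewrite e|exists (w x)].
  have fP : is_hom_cell (fun x => [set f x]).
    (* The map [f x] need not belong to [sval t x], so this is not a face of [t]; but its values lie
       in [prod_cell t], where adjacency is already known. *)
    apply: is_hom_cell_vertex => x x' xx' y y' yy'.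
    exact: (prod_edge _ _ _ _ xx' yy' _ _ (tf _ _) (tf _ _)).
  by exists (exist _ _ fP) => _; exists a.
apply: (finite_set_inj (f := c) fin) => p q /cE[a [aw cp]] /cE[b [bw cq]] cpq.
have := cp p.1; rewrite cpq cq => /seteqP[/(_ _ erefl) + _].
move=> /(congr1 (@^~ p.2)) /=; rewrite -surjective_pairing.
case: (pselect (p = p)) => [_|//] /=; case: pselect => //= _ wa.
by case: aw.
Qed.

Definition hom_compatible (G H K : graph) (c : hom_cell (gprod G H) K)
    (t : hom_cell G (gpower K H)) : Prop :=
  exists2 z : hom_cell (gprod G H) K, hom_face c z &
    forall x, sval t x `<=` power_cell z x.

Theorem mainTheorem3 (R : realType) (G H K : graph)
  (finGH : finite_complex (Hom R (gprod G H) K))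
  (finKH : finite_complex (Hom R G (gpower K H))) :
  simple_homotopy_equivalent (Hom R (gprod G H) K) (Hom R G (gpower K H)).
Proof.
apply: (@fibre_collapses_equivalent R (Hom R (gprod G H) K) (Hom R G (gpower K H))
  (@hom_compatible G H K)) => //.
- move=> c c' t t' [z cz tz] c'c t't; exists z; first exact: hom_face_trans cz.
  by move=> x f /t't/tz.
- move=> t; have [w tw] := choice (hom_cell_neq0 (svalP t)).
  (* Every [z] witnessing compatibility with [t] contains the uncurried vertex [w] of [t], so it
     also witnesses star-shapedness. The fibre is nonempty because of [prod_cell t]. *)
  apply: (@star_shaped_collapses R (gprod G H) K _ (fun p => w p.1 p.2)).
  + exact: sub_finite_set finGH.
  + exists (exist _ _ (is_hom_cell_prod t finKH)).
    exists (exist _ _ (is_hom_cell_prod t finKH)); first exact: hom_face_refl.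
    move=> x f tf y.
    by exists f.
  + move=> c [z cz tz]; exists z; split=> // [[x y]|d dz]; first exact: tz.
    by exists z.
- move=> c; have [v cv] := choice (hom_cell_neq0 (svalP c)).
  apply: (@star_shaped_collapses R G (gpower K H) _ (fun x y => v (x, y))).
  + exact: sub_finite_set finKH.
  + exists (exist _ _ (is_hom_cell_power c finGH)).
    by exists c => [|x]; [exact: hom_face_refl|exact: subset_refl].
  (* Here the witness is [power_cell z]: it contains [t], it contains the curried vertex [v] of [c]
     since [c] is a face of [z], and all its faces are compatible with [c] through the same [z]. *)
  + move=> t [z cz tz]; exists (exist _ _ (is_hom_cell_power z finGH)); split=> //.
      by move=> x y; apply/cz/cv.
    by move=> d dz; exists z.
Qed.
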